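(* Let $f:\mathbb{R}^n\to\mathbb{R}^n$ be homogeneous of degree $\nu\in\mathbb{R}$ with $f(0)=0$, and consider the dynamic system $\frac{d}{dt}x=f(x)$. Let $P:\mathbb{R}^n\to\mathbb{R}$ be a polynomial of degree $p\ge 1$, written as $P(x)=\sum_{i=0}^{p}M_i(x)$ with $M_i$ a homogeneous polynomial of degree $i$, and set $\tilde P(x,\tau)=\sum_{i=0}^{p}M_i(x)\,\tau^{p-i}$. Assume: (i) the set $\{x\in\mathbb{R}^n: P(x)\le 0\}$ is bounded and $P(0)<0$ (so $P<0$ inside the level set $\{P=0\}$ and $P>0$ outside it); (ii) (invariance) $\nabla P(x)^T f(x)<0$ for every $x\in\mathbb{R}^n$ with $P(x)=0$; (iii) (unicity) for every $x\in\mathbb{R}^n\setminus\{0\}$ there is exactly one $c>0$ such that $\tilde P(x,c)=0$. Define $\tau:\mathbb{R}^n\to[0,\infty)$ by letting $\tau(x)$ be the unique $c>0$ with $\tilde P(x,c)=0$ if $x\ne 0$, and $\tau(0)=0$. Then $\tau$ is a Lyapunov function for the system $\frac{d}{dt}x=f(x)$.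
   Context: A function $f:\mathbb{R}^n\to\mathbb{R}^n$ is homogeneous of degree $\nu$ if $f(\lambda x)=\lambda^{\nu+1}f(x)$ for every $\lambda>0$ and every $x\in\mathbb{R}^n$ (for example, a linear map $x\mapsto Ax$ is homogeneous of degree $0$). A polynomial $M_i$ is homogeneous of degree $i$ if all its monomials have degree $i$ (the zero polynomial is allowed). Thus $\tilde P$ is homogeneous of degree $p$ in $(x,\tau)$, $\tilde P(x,1)=P(x)$, and for $c>0$ the equation $\tilde P(x,c)=0$ is equivalent to $P(x/c)=0$. A trajectory of the system is a differentiable function $x(\cdot)$ on an interval satisfying $\dot x(t)=f(x(t))$. A function $V:\mathbb{R}^n\to\mathbb{R}$ is a Lyapunov function for the system if it is continuous, $V(0)=0$, $V(x)>0$ for all $x\neq 0$, and $t\mapsto V(x(t))$ is strictly decreasing along every trajectory $x(\cdot)$ on any time interval on which $x(t)\ne 0$. *)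

(* Defs.v *)
From mathcomp Require Import all_boot all_order all_algebra.
From mathcomp Require Import mpoly.
From mathcomp Require Import boolp classical_sets reals topology normedtype derive exp.

Set Implicit Arguments.
Unset Strict Implicit.
Unset Printing Implicit Defensive.

Import Order.TTheory GRing.Theory Num.Theory.
Import numFieldNormedType.Exports.

Local Open Scope classical_set_scope.
Local Open Scope ring_scope.

(* Points of R^n are row vectors, with the topology of the sup norm. *)

(* Only positive scalars are considered, so [powR] is the usual real power. *)
Definition homogeneous_map (R : realType) (n : nat)
    (f : 'rV[R]_n -> 'rV[R]_n) (nu : R) : Prop :=
  forall (lambda : R) (x : 'rV[R]_n),
    0 < lambda -> f (lambda *: x) = lambda `^ (nu + 1) *: f x.

Definition polyfun (R : realType) (n : nat) (P : {mpoly R[n]})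
    (x : 'rV[R]_n) : R :=
  P.@[fun i => x 0 i].

Definition gradient (R : realType) (n : nat) (g : 'rV[R]_n -> R)
    (x : 'rV[R]_n) : 'rV[R]_n :=
  \row_i 'D_(delta_mx 0 i) g x.

Definition homogenization (R : realType) (n p : nat)
    (M : 'I_p.+1 -> {mpoly R[n]}) (x : 'rV[R]_n) (t : R) : R :=
  \sum_(i < p.+1) polyfun (M i) x * t ^+ (p - i).

(* [xget 0] picks an element of the set of positive roots; it falls back to 0
   only when that set is empty. *)
Definition tau (R : realType) (n p : nat) (M : 'I_p.+1 -> {mpoly R[n]})
    (x : 'rV[R]_n) : R :=
  if x == 0 then 0
  else xget 0 [set c : R | 0 < c /\ homogenization M x c = 0].

(* The derivative is taken relative to [I]: two-sided at interior points and
   one-sided at the endpoints belonging to [I].  The values of [x] outside [I]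
   are irrelevant. *)
Definition trajectory (R : realType) (n : nat) (f : 'rV[R]_n -> 'rV[R]_n)
    (I : set R) (x : R -> 'rV[R]_n) : Prop :=
  is_interval I /\
  forall t : R, I t ->
    (s - t)^-1 *: (x s - x t) @[s --> within I t^'] --> f (x t).

Definition lyapunov (R : realType) (n : nat) (f : 'rV[R]_n -> 'rV[R]_n)
    (V : 'rV[R]_n -> R) : Prop :=
  [/\ continuous V,
      V 0 = 0,
      forall x : 'rV[R]_n, x != 0 -> 0 < V x
    & forall (I : set R) (x : R -> 'rV[R]_n), trajectory f I x ->
      forall J : set R, is_interval J -> J `<=` I ->
      (forall t, J t -> x t != 0) ->
      forall s t : R, J s -> J t -> s < t -> V (x t) < V (x s)].

(* Main.v *)
Require Import Defs.
From mathcomp Require Import all_boot all_order all_algebra.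
From mathcomp Require Import mpoly.
From mathcomp Require Import boolp classical_sets functions reals topology normedtype landau derive exp.
From mathcomp Require Import ring lra.

(** Write [P] also for the polynomial function. Homogeneity of the [M i] gives
    [homogenization M x c = c ^+ p * P (c^-1 *: x)] for [c <> 0]
    ([homogenizationE]), so for [x <> 0] the value [tau x] is the only [c > 0]
    for which [x / c] lies on the level set [P = 0]: [tau] is the Minkowski gauge of the sublevel set
    [P <= 0]. Polynomials matter only through this identity and through their
    smoothness; the rest concerns a function [Q] on a normed space.

    On the ray through [x], the function [s |-> Q (s *: x)] is negative at 0,
    positive far away because [Q <= 0] is bounded, and has a single zero. By the
    intermediate value theorem its sign tells on which side of the zero [s] is:
    [V x < c] iff [Q (x / c) < 0], and [c < V x] iff [Q (x / c) > 0]
    ([gauge_ltE], [gauge_gtE]). Comparing [V] with a constant [c] is thus an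
    open condition on [x], whence the continuity of the gauge.

    The same equivalences spare any differentiation of [tau]. At a time [t] of a
    trajectory, fix [c = tau (x t)] and follow [s |-> P (x s / c)]. It vanishes
    at [t], and by homogeneity of [f] its derivative there is a positive multiple
    of [grad P . f] at the point [x t / c] of the level set, hence negative. So it
    changes sign from positive to negative at [t], that is, [tau (x s)] is above
    [c] just before [t] and below [c] just after ([gauge_decreasing]). A real
    function with this local property at each point of an interval is strictly
    decreasing there, by a least upper bound argument ([decreasing_of_local]). *)

Import Order.TTheory GRing.Theory Num.Theory.
Import numFieldNormedType.Exports.

Local Open Scope classical_set_scope.
Local Open Scope ring_scope.

Set Implicit Arguments.
Unset Strict Implicit.
Unset Printing Implicit Defensive.

(** * One-variable calculus relative to a set *)

Lemma within_dnbhs_filter (R : realType) (D : set R) (t : R) :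
  Filter (within D t^').
Proof. by do 2!apply: within_filter; exact: nbhs_filter. Qed.

Lemma near_within_sub_neq0 (R : realType) (D : set R) (t : R) :
  \forall s \near within D t^', s - t != 0.
Proof.
apply: cvg_within; apply: filterS (nbhs_dnbhs_neq t) => s.
by rewrite subr_eq0.
Qed.

(** The local property on the left carries the bound [V v < V a] to the supremum
    of the points up to which it holds, and the local property on the right then
    carries it further. *)
Lemma decreasing_of_local (R : realType) (V : R -> R) (J : set R) :
  is_interval J ->
  (forall t, J t -> \forall s \near within J t^', (s - t) * (V s - V t) < 0) ->
  forall s t, J s -> J t -> s < t -> V t < V s.
Proof.
move=> Jint loc a b Ja Jb ab.
have Jab z : a <= z <= b -> J z by apply: Jint.
have {}loc t : J t -> exists2 e, 0 < e & forall s, J s ->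
    `|t - s| < e -> (t < s -> V s < V t) /\ (s < t -> V t < V s).
  move=> /[dup] Jt /loc.
  rewrite /prop_near1 /within /= /dnbhs /within /= => /nbhs_ballP[e /= e0 He].
  exists e => // s Js ts; split=> lt_ts.
    have := He s ts; rewrite gt_eqF // => /(_ isT Js).
    by rewrite pmulr_rlt0 ?subr_gt0 // subr_lt0.
  have := He s ts; rewrite lt_eqF // => /(_ isT Js).
  by rewrite nmulr_rlt0 ?subr_lt0 // subr_gt0.
(* [a] itself is in [S], where the second condition is empty; this makes the
   supremum argument uniform even when [sup S = a]. *)
pose S := [set u | a <= u <= b /\ forall v, a < v <= u -> V v < V a].
have Sa : S a.
  split=> [|v /andP[av /(lt_le_trans av)]]; first by rewrite lexx ltW.
  by rewrite ltxx.
have S0 : S !=set0 by exists a.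
have Sub : has_ubound S by exists b => u [/andP[]].
pose m := sup S.
have am : a <= m by apply: ub_le_sup.
have mb : m <= b by apply: ge_sup => // u [/andP[]].
have Jm : J m by apply: Jab; rewrite am.
have [d d0 Hd] := loc m Jm.
have below v : a < v < m -> V v < V a.
  move=> /andP[av vm]; have [u [_ Su] vu] := sup_gt S0 vm.
  by apply: Su; rewrite av ltW.
have Sm : S m.
  split; first by rewrite am.
  move=> v /andP[av]; rewrite le_eqVlt => /predU1P[vm|vm]; last first.
    by apply: below; rewrite av.
  rewrite {}vm {v} in av *.
  (* The local property on the left of [m] compares [V m] with an earlier value,
     already known to be below [V a]. *)
  have /(@midf_lt _) : Num.max a (m - d) < m by rewrite gt_max av ltrBlDr ltrDl.
  set c := _ / 2 => -[]; rewrite gt_max => /andP[ac dc] cm.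
  have Jc : J c by apply: Jab; rewrite (ltW ac) (le_trans (ltW cm)).
  have [_ Vmc] := Hd c Jc (ltac:(rewrite gtr0_norm ?subr_gt0 //; lra)).
  apply: lt_trans (Vmc cm) _; apply: below; exact/andP.
move: mb; rewrite le_eqVlt => /predU1P[m_eq|mb].
  by case: Sm => _; apply; rewrite ab m_eq /=.
exfalso.
(* The local property on the right of [m] puts a point beyond [m] in [S]. *)
have mc : m < Num.min b (m + d / 2) by rewrite lt_min mb ltrDl divr_gt0.
suff /(ub_le_sup Sub) : S (Num.min b (m + d / 2)) by rewrite -/m leNgt mc.
split; first by rewrite (le_trans am (ltW mc)) ge_min lexx.
move=> v /andP[av]; rewrite le_min => /andP[vb vd].
case: (leP v m) => [vm|mv]; first by case: Sm => _; apply; rewrite av.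
have Jv : J v by apply: Jab; rewrite (ltW av).
have [Vvm _] := Hd v Jv (ltac:(rewrite distrC gtr0_norm ?subr_gt0 //; lra)).
apply: lt_le_trans (Vvm mv) _.
move: am; rewrite le_eqVlt => /predU1P[<-//|am].
by case: Sm => _ /(_ m); rewrite am lexx => /(_ isT)/ltW.
Qed.

(** The chain rule for a curve [z] that is differentiable only relative to [D],
    as a trajectory is at an endpoint of its interval. *)
Lemma cvg_diff_quotient (R : realType) (E : normedModType R) (F : E -> R)
    (z : R -> E) (D : set R) (t : R) (w : E) :
  differentiable F (z t) ->
  (s - t)^-1 *: (z s - z t) @[s --> within D t^'] --> w ->
  (s - t)^-1 * (F (z s) - F (z t)) @[s --> within D t^'] --> 'd F (z t) w.
Proof.
move=> dF zw.
have FF := within_dnbhs_filter D t.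
have to_t : within D t^' --> t.
  exact: cvg_trans (@cvg_within _ _ _ D) (@cvg_within _ _ _ _).
have st := near_within_sub_neq0 D t.
have sub0 : s - t @[s --> within D t^'] --> (0 : R).
  by rewrite -(subrr t); apply: cvgB; [exact: to_t|exact: cvg_cst].
have h0 : z s - z t @[s --> within D t^'] --> (0 : E).
  rewrite -(scale0r w).
  apply: cvg_trans (cvgZ sub0 zw); apply: near_eq_cvg.
  by near do rewrite scalerA divff ?scale1r //.
pose r h : R := F (h + z t) - (F (z t) + 'd F (z t) h).
have r0 e : 0 < e -> \forall h \near (0 : E), `|r h| <= e * `|h|.
  by have /diff_locally/eqaddoP := dF; apply.
rewrite -[X in _ --> X]addr0.
apply: (@cvg_trans _ ('d F (z t) ((s - t)^-1 *: (z s - z t)) +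
    (s - t)^-1 * r (z s - z t) @[s --> within D t^'])).
  apply: near_eq_cvg; apply: nearW => s.
  rewrite /r subrK linearZ /=; rewrite -mulrDr; congr (_ * _).
  ring.
apply: cvgD.
  by apply: cvg_comp zw _; apply: diff_continuous.
(* The remainder is at most [e / (`|w| + 1)] times the increment of [z], whose
   quotient by [s - t] is eventually at most [`|w| + 1]. *)
apply/cvgr0Pnorm_le => e e0.
have K0 : 0 < `|w| + 1 by rewrite ltr_pwDr.
have qK : \forall s \near within D t^', `|(s - t)^-1 *: (z s - z t)| < `|w| + 1.
  by have /cvgr_norm_lt := zw; apply; rewrite ltrDl.
have rK := h0 _ (r0 (e / (`|w| + 1)) (divr_gt0 e0 K0)).
near=> s.
rewrite normrM; apply: (@le_trans _ _
  (`|(s - t)^-1| * ((e / (`|w| + 1)) * `|z s - z t|))).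
  by apply: ler_wpM2l => //; near: s; exact: rK.
rewrite mulrCA -normrZ -mulrA ler_piMr ?(ltW e0) //.
by rewrite mulrC ler_pdivrMr // mul1r ltW //; near: s.
Unshelve. all: by end_near.
Qed.

(** * The gauge of a sublevel set *)

(** When [Q <= 0] is a neighborhood of 0 which each ray leaves exactly once, [V] is
    its Minkowski gauge, described here by its values on the boundary [Q = 0]. *)
Definition is_gauge (R : realType) (E : normedModType R) (Q V : E -> R) : Prop :=
  V 0 = 0 /\ forall x, x != 0 ->
    [/\ 0 < V x, Q ((V x)^-1 *: x) = 0 &
        forall c, 0 < c -> Q (c^-1 *: x) = 0 -> c = V x].

(** The intermediate value theorem along the ray through [x]. *)
Lemma ray_root (R : realType) (E : normedModType R) (Q : E -> R) (x : E) (a b : R) :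
  continuous Q -> a <= b -> Q (a *: x) * Q (b *: x) <= 0 ->
  exists2 c, a <= c <= b & Q (c *: x) = 0.
Proof.
move=> cQ ab sgn.
have cq : continuous (fun s : R => Q (s *: x)).
  move=> s; apply: continuous_comp; last exact: cQ.
  exact: scalel_continuous.
have [c cab Qc] := @IVT R (fun s => Q (s *: x)) a b 0 ab
  (continuous_subspaceT cq) ltac:(rewrite ge_min le_max; nra).
by exists c.
Qed.

Section Gauge.

Context (R : realType) (E : normedModType R) (Q V : E -> R).
Context (cQ : continuous Q) (Q0 : Q 0 < 0).
Context (bQ : bounded_set [set y | Q y <= 0]) (gV : is_gauge Q V).

(** If [Q] were nonnegative at [c^-1 *: x], it would vanish between 0 and there,
    that is, at [c'^-1 *: x] for some [c' >= c > V x]. *)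
Lemma gauge_inside (x : E) (c : R) :
  0 < c -> V x < c -> Q (c^-1 *: x) < 0.
Proof.
have [_ gx] := gV; move=> c0 Vc.
have [->|x0] := eqVneq x 0; first by rewrite scaler0.
have [V0 _ uV] := gx x x0.
rewrite ltNge; apply/negP => Qc.
have ci : 0 <= c^-1 by rewrite invr_ge0 ltW.
have [s /andP[s0 sc] Qs] := @ray_root R E Q x 0 c^-1 cQ ci
  ltac:(by rewrite scale0r nmulr_rle0).
have {}s0 : 0 < s.
  rewrite lt_neqAle s0 andbT; apply: contraTneq Q0 => s0'.
  by rewrite -s0' scale0r in Qs; rewrite Qs ltxx.
have := uV s^-1; rewrite invrK invr_gt0 => /(_ s0 Qs) sV.
move: Vc; rewrite -sV ltNge; apply/negP/negPn.
by rewrite -(invrK c) lef_pV2 // posrE ?invr_gt0.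
Qed.

(** If [Q] were nonpositive at [c^-1 *: x], it would vanish between there and a
    far point of the ray, that is, at [c'^-1 *: x] for some [c' <= c < V x]. *)
Lemma gauge_outside (x : E) (c : R) :
  0 < c -> c < V x -> 0 < Q (c^-1 *: x).
Proof.
have [gV0 gx] := gV; have [K [_ leK]] := bQ; move=> c0 cV.
have [x0|x0] := eqVneq x 0.
  by move: cV; rewrite x0 gV0 ltNge ltW.
have [V0 _ uV] := gx x x0.
rewrite ltNge; apply/negP => Qc.
(* The second term of the maximum pushes [S *: x] out of the ball that contains
   the sublevel set. *)
pose S := Num.max c^-1 ((`|K| + 2) / `|x|).
have nx : 0 < `|x| by rewrite normr_gt0.
have S0 : 0 < S by rewrite lt_max invr_gt0 c0.
have QS : 0 < Q (S *: x).
  rewrite ltNge; apply/negP => /(leK (`|K| + 1)).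
  have -> : K < `|K| + 1 by rewrite (le_lt_trans (ler_norm K)) // ltrDl.
  move=> /(_ isT) /=; rewrite normrZ gtr0_norm // leNgt => /negP; apply.
  rewrite -ltr_pdivrMr // lt_max; apply/orP; right.
  by rewrite ltr_pM2r ?invr_gt0 // ltrD2l ltr1n.
have [s /andP[cs _] Qs] := @ray_root R E Q x c^-1 S cQ
  ltac:(by rewrite le_max lexx) ltac:(by rewrite pmulr_lle0).
have s0 : 0 < s by apply: lt_le_trans cs; rewrite invr_gt0.
have := uV s^-1; rewrite invrK invr_gt0 => /(_ s0 Qs) sV.
move: cV; rewrite -sV ltNge; apply/negP/negPn.
by rewrite -(invrK c) lef_pV2 // posrE ?invr_gt0.
Qed.

(** The point 0 is included: both sides then hold, as [V 0 = 0] and [Q 0 < 0]. *)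
Lemma gauge_ltE (x : E) (c : R) :
  0 < c -> (V x < c) = (Q (c^-1 *: x) < 0).
Proof.
move=> c0; apply/idP/idP; first exact: gauge_inside.
apply: contraTT; rewrite -!leNgt le_eqVlt => /predU1P[cV|]; last first.
  by move=> /(gauge_outside c0)/ltW.
have [x0|x0] := eqVneq x 0.
  by move: c0; rewrite cV x0 (proj1 gV) ltxx.
by have [_ Vx _] := (proj2 gV) x x0; rewrite cV Vx.
Qed.

(** The point 0 is included: both sides are then false. *)
Lemma gauge_gtE (x : E) (c : R) :
  0 < c -> (c < V x) = (0 < Q (c^-1 *: x)).
Proof.
move=> c0; apply/idP/idP; first exact: gauge_outside.
apply: contraTT; rewrite -!leNgt le_eqVlt => /predU1P[cV|]; last first.
  by move=> /(gauge_inside c0)/ltW.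
have [x0|x0] := eqVneq x 0; first by rewrite x0 scaler0 ltW.
by have [_ Vx _] := (proj2 gV) x x0; rewrite -cV Vx.
Qed.

Lemma gauge_ge0 (x : E) : 0 <= V x.
Proof.
have [V0 gx] := gV.
by have [->|/gx[/ltW]//] := eqVneq x 0; rewrite V0.
Qed.

Lemma gauge_continuous : continuous V.
Proof.
move=> x; apply/cvgrPdist_le => e e0.
have cQc c : Q (c^-1 *: y) @[y --> x] --> Q (c^-1 *: x).
  apply: (@continuous_comp _ _ _ (fun y : E => c^-1 *: y) Q); last exact: cQ.
  exact: scaler_continuous.
(* Both one-sided bounds compare [V] with a fixed positive constant. *)
have up : \forall y \near x, V y < V x + e.
  have c0 : 0 < V x + e by rewrite ltr_wpDl // gauge_ge0.
  have : Q ((V x + e)^-1 *: x) < 0 by rewrite -(gauge_ltE _ c0) ltrDl.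
  move=> /(cvgr_lt _ (cQc _)); apply: filterS => y.
  by rewrite -(gauge_ltE _ c0).
have lo : \forall y \near x, V x - e <= V y.
  (* No comparison is available with a nonpositive constant, but then [0 <= V]
     suffices. *)
  have [c0|c0] := leP (V x - e) 0.
    by apply: nearW => y; rewrite (le_trans c0) // gauge_ge0.
  have : 0 < Q ((V x - e)^-1 *: x) by rewrite -(gauge_gtE _ c0) ltrBlDr ltrDl.
  move=> /(cvgr_gt _ (cQc _)); apply: filterS => y.
  by rewrite -(gauge_gtE _ c0) => /ltW.
near=> y; rewrite ler_distlC; apply/andP; split; last apply: ltW; by near: y.
Unshelve. all: by end_near.
Qed.

(** With [c = V (z t)] fixed, [s |-> Q (c^-1 *: z s)] has a negative derivative at
    its zero [t], and its sign decides how [V (z s)] compares with [c]. *)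
Lemma gauge_decreasing (D : set R) (z : R -> E) (t : R) (w : E) :
  z t != 0 ->
  let y := (V (z t))^-1 *: z t in
  differentiable Q y -> 'd Q y w < 0 ->
  (s - t)^-1 *: (z s - z t) @[s --> within D t^'] --> w ->
  \forall s \near within D t^', (s - t) * (V (z s) - V (z t)) < 0.
Proof.
move=> zt0 y dQ dw zw.
have [Vt0 Qy _] := proj2 gV _ zt0.
have FF := within_dnbhs_filter D t.
set c := V (z t) in y Vt0 Qy dQ dw *.
have yE s : (s - t)^-1 *: (c^-1 *: z s - c^-1 *: z t) =
            c^-1 *: ((s - t)^-1 *: (z s - z t)).
  by rewrite -scalerBr !scalerA mulrC.
have /(cvg_diff_quotient dQ) : (s - t)^-1 *: (c^-1 *: z s - c^-1 *: z t)
    @[s --> within D t^'] --> c^-1 *: w.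
  under eq_fun do rewrite yE.
  by apply: cvgZ; [exact: cvg_cst|exact: zw].
rewrite linearZ /= => /cvgr_lt /(_ 0).
rewrite pmulr_rlt0 ?invr_gt0 // => /(_ dw) near_lt0.
apply: filterS2 near_lt0 (near_within_sub_neq0 D t) => s; rewrite Qy subr0 => Qs.
rewrite neq_lt => /orP[st|st].
  rewrite nmulr_rlt0 // subr_gt0 (gauge_gtE _ Vt0).
  by move: Qs; rewrite nmulr_rlt0 // invr_lt0.
rewrite pmulr_rlt0 // subr_lt0 (gauge_ltE _ Vt0).
by move: Qs; rewrite pmulr_rlt0 // invr_gt0.
Qed.

End Gauge.

(** * Polynomial functions and the homogenization *)

Lemma differentiable_polyfun (R : realType) (n : nat) (P : {mpoly R[n]})
    (x : 'rV[R]_n) : differentiable (polyfun P) x.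
Proof.
elim/mpolyind: P => [|c m p _ _ IH].
  rewrite (_ : polyfun 0 = cst 0); first exact: differentiable_cst.
  by apply/funext => y; rewrite /polyfun meval0.
rewrite (_ : polyfun _ =
    c *: (\prod_(i < n) (fun y : 'rV[R]_n => y 0 i) ^+ m i) + polyfun p).
  apply: differentiableD => //; apply: differentiableZ.
  elim/big_ind: _ => [|g h dg dh|i _]; first exact: differentiable_cst.
    exact: differentiableM.
  case: (m i) => [|k]; first exact: differentiable_cst.
  by apply: differentiableX; exact: differentiable_coord.
apply/funext => y; rewrite /polyfun mevalD mevalZ mevalX !fctE fct_prodE.
by congr (_ * _ + _); apply: eq_bigr => i _; rewrite exprfctE.
Qed.

Lemma diff_gradient (R : realType) (n : nat) (g : 'rV[R]_n -> R)
    (x v : 'rV[R]_n) : differentiable g x ->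
  'd g x v = \sum_(i < n) gradient g x 0 i * v 0 i.
Proof.
move=> dg; rewrite {1}(row_sum_delta v) linear_sum; apply: eq_bigr => i _.
by rewrite linearZ /= mxE deriveE // mulrC.
Qed.

Lemma polyfun_homogZ (R : realType) (n d : nat) (P : {mpoly R[n]}) (c : R)
    (x : 'rV[R]_n) : P \is d.-homog -> polyfun P (c *: x) = c ^+ d * polyfun P x.
Proof.
move=> /dhomogP hP; rewrite /polyfun !mevalE mulr_sumr.
rewrite big_seq [RHS]big_seq; apply: eq_bigr => m /hP md.
rewrite mulrCA; congr (_ * _).
under eq_bigr => i _ do rewrite mxE exprMn.
by rewrite big_split /= prodrXr -md -mdegE.
Qed.

Lemma homogenizationE (R : realType) (n p : nat) (M : 'I_p.+1 -> {mpoly R[n]})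
    (x : 'rV[R]_n) (c : R) :
  (forall i, M i \is i.-homog) -> c != 0 ->
  homogenization M x c = c ^+ p * polyfun (\sum_i M i) (c^-1 *: x).
Proof.
move=> hM c0; have -> : polyfun (\sum_i M i) (c^-1 *: x) =
    \sum_i polyfun (M i) (c^-1 *: x) by exact: raddf_sum.
rewrite mulr_sumr; apply: eq_bigr => i _.
rewrite (polyfun_homogZ _ _ (hM i)) mulrC mulrA exprVn.
by rewrite expfB_cond // (negbTE c0) add0n -ltnS.
Qed.

(** * Homogeneous systems with an invariant level set *)

Theorem proposition1 (R : realType) (n : nat)
    (f : 'rV[R]_n -> 'rV[R]_n) (nu : R)
    (f_homog : homogeneous_map f nu) (f0 : f 0 = 0)
    (p : nat) (p_ge1 : (1 <= p)%N)
    (P : {mpoly R[n]}) (P_deg : msize P = p.+1)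
    (M : 'I_p.+1 -> {mpoly R[n]})
    (M_homog : forall i : 'I_p.+1, M i \is i.-homog)
    (P_eq : P = \sum_(i < p.+1) M i)
    (P_bounded : bounded_set [set x : 'rV[R]_n | polyfun P x <= 0])
    (P0_lt0 : polyfun P 0 < 0)
    (invariance : forall x : 'rV[R]_n, polyfun P x = 0 ->
       \sum_(i < n) gradient (polyfun P) x 0 i * f x 0 i < 0)
    (unicity : forall x : 'rV[R]_n, x != 0 ->
       exists! c : R, 0 < c /\ homogenization M x c = 0) :
  lyapunov f (tau M).
Proof.
pose Q := polyfun P.
have dQ y : differentiable Q y by exact: differentiable_polyfun.
have cQ : continuous Q by move=> y; exact: differentiable_continuous.
have root_iff x c : 0 < c ->
    (homogenization M x c = 0) <-> (Q (c^-1 *: x) = 0).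
  move=> c0; rewrite homogenizationE ?gt_eqF // -P_eq -/Q.
  split=> [/eqP|->]; last by rewrite mulr0.
  by rewrite mulf_eq0 expf_eq0 gt_eqF // andbF => /eqP.
have gV : is_gauge Q (tau M).
  split=> [|x x0]; first by rewrite /tau eqxx.
  have [r [[r0 hr] ur]] := unicity x x0.
  have -> : tau M x = r.
    rewrite /tau (negbTE x0); case: xgetP => [c _ /ur//|/(_ r)].
    by case.
  split=> [//||c c0 Qc]; first by rewrite -root_iff.
  by apply/esym/ur; split=> //; rewrite root_iff.
split.
- exact: gauge_continuous cQ P0_lt0 P_bounded gV.
- exact: (proj1 gV).
- by move=> x /(proj2 gV)[].
move=> I x [_ trajx] J Jint JI xn0.
apply: (@decreasing_of_local R (tau M \o x) J) => // t Jt /=.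
have [c0 Qy _] := proj2 gV _ (xn0 t Jt).
set c := tau M (x t) in c0 Qy.
(* Homogeneity moves the velocity to the level set, where [invariance] speaks;
   the factor is positive. *)
have fE : f (x t) = c `^ (nu + 1) *: f (c^-1 *: x t).
  by rewrite -f_homog // scalerA divff ?scale1r ?gt_eqF.
have xt : (s - t)^-1 *: (x s - x t) @[s --> within J t^'] --> f (x t).
  apply: cvg_trans (trajx t (JI _ Jt)); apply: cvg_app => A.
  have FF : Filter t^' by apply: within_filter; exact: nbhs_filter.
  by rewrite /within /=; apply: (@filterS _ _ FF) => s IA /JI /IA.
apply: (gauge_decreasing cQ P0_lt0 P_bounded gV (xn0 t Jt) _ _ xt) => //.
rewrite -/c fE linearZ /= pmulr_rlt0 ?powR_gt0 // diff_gradient //.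
exact: invariance.
Qed.
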